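(* Let $q\equiv 3\pmod 4$ be a prime power, let $a\in\mathbb{F}_q^*$ be a square in $\mathbb{F}_q$, let $b\in\mathbb{F}_q$ satisfy $b^2=a$, and let $n$ be an even positive integer such that $\operatorname{rad}(n)$ divides $q-1$. Then for every irreducible factor $f(x)$ of $D_n(x,a)$ in $\mathbb{F}_q[x]$ there exist $\alpha\in\mathbb{F}_{q^2}^*$ and a positive divisor $t$ of $\frac{4n}{\gcd(4n,q^2-1)}$ satisfying (i) $\alpha^{2n/t}=-1$, (ii) $\operatorname{rad}(t)$ divides $\operatorname{ord}_{q^2}(\alpha)$, (iii) $\gcd\left(t,\frac{q^2-1}{\operatorname{ord}_{q^2}(\alpha)}\right)=1$, such that $f(x)$ is of the following type: (a) $f(x)=D_t(x,a)-b^t(\alpha+\alpha^{-1})$ in the case that $\alpha\in\mathbb{F}_q^*$ or $\alpha^{q+1}=1$; (b) $f(x)=\left(D_t(x,a)-b^t(\alpha+\alpha^{-1})\right)\left(D_t(x,a)-b^t(\alpha^q+\alpha^{-q})\right)$ otherwise.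
   Context: For $n\ge 1$ and $a\in\mathbb{F}_q$, the $n$-th Dickson polynomial of the first kind with parameter $a$ is $D_n(x,a)=\sum_{i=0}^{\lfloor n/2\rfloor}\frac{n}{n-i}\binom{n-i}{i}(-a)^i x^{n-2i}\in\mathbb{F}_q[x]$ (the numbers $\frac{n}{n-i}\binom{n-i}{i}$ are integers, viewed in $\mathbb{F}_q$). $\operatorname{rad}(n)$ is the product of the distinct primes dividing $n$, with $\operatorname{rad}(1)=1$. $\operatorname{ord}_{q^2}(\alpha)$ is the multiplicative order of $\alpha$ in the cyclic group $\mathbb{F}_{q^2}^*$. Irreducible factors are normalized to be monic. *)

(* Defs.v *)
From HB Require Import structures.
From mathcomp Require Import all_boot all_order all_algebra all_fingroup.

Set Implicit Arguments.
Unset Strict Implicit.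
Unset Printing Implicit Defensive.

Import GRing.Theory.
Local Open Scope ring_scope.

Definition radn (n : nat) : nat := (\prod_(p <- primes n) p)%N.

(* The integer n / (n - i) * 'C(n - i, i); the division is exact for
   i <= n./2, see dickson_coef_dvd. *)
Definition dickson_coef (n i : nat) : nat := ((n * 'C(n - i, i)) %/ (n - i))%N.

Lemma dickson_coef_dvd (n i : nat) :
  (i <= n./2)%N -> (n - i %| n * 'C(n - i, i))%N.
Proof.
move=> le_i; have le_in : (i <= n)%N.
  by rewrite (leq_trans le_i) // -{2}(odd_double_half n) -addnn addnA leq_addl.
rewrite -[X in (_ %| X * _)%N](subnK le_in) mulnDl.
rewrite dvdn_addr; last exact: dvdn_mulr.
case: i {le_i} le_in => [|i] le_in; first by rewrite dvdn0.
by rewrite -mul_bin_diag dvdn_mulr.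
Qed.

(* Dickson polynomial of the first kind, for n > 0; the conventional
   D_0 = 2 is not covered by this formula. *)
Definition dickson (R : nzRingType) (n : nat) (a : R) : {poly R} :=
  \sum_(i < n./2.+1) ((- a) ^+ i *+ dickson_coef n i) *: 'X^(n - i.*2).

(* Main.v *)
(* Over an algebraic closure write a root of f as x = b (y + 1/y). Since
   D_n(b (y + 1/y), b^2) = b^n (y^n + y^-n), we get y^(2n) = -1. Let o be the
   order of y, t = o / gcd(o, q^2 - 1) and alpha = y^t, which has order
   gcd(o, q^2 - 1) and hence lies in F_(q^2). As rad(o) divides q^2 - 1, lifting
   the exponent shows that y has t distinct conjugates over F_(q^2), and so does
   x because alpha^2 != 1. Therefore the monic polynomial
   g = D_t(x, a) - b^t (alpha + 1/alpha), of degree t, is the minimal polynomial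
   of x over F_(q^2), and f is the product of the conjugates of g over F_q. *)
Require Import Defs.
From HB Require Import structures.
From mathcomp Require Import all_boot all_order all_algebra all_fingroup.
From mathcomp Require Import all_solvable all_field.
From mathcomp Require Import ring zify.

Set Implicit Arguments.
Unset Strict Implicit.
Unset Printing Implicit Defensive.

Import GRing.Theory.
Local Open Scope ring_scope.

(** * Dickson polynomials: coefficients, recurrence, degree, functional equation *)

Lemma dickson_coef0 (n : nat) : (0 < n)%N -> dickson_coef n 0 = 1%N.
Proof. by move=> n_gt0; rewrite /dickson_coef subn0 bin0 muln1 divnn n_gt0. Qed.

(** Split the factor n as (n - i - 1) + (i + 1) and use (i + 1) C(n - i - 1, i + 1) = (n - i - 1)
    C(n - i - 2, i). In this division-free form Pascal's rule gives the recurrence of the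
    coefficients. *)
Lemma dickson_coefS (n i : nat) : (i.+1 < n)%N ->
  dickson_coef n i.+1 = ('C(n - i.+1, i.+1) + 'C(n - i.+2, i))%N.
Proof.
move=> lt_in; rewrite /dickson_coef.
have m_gt0: (0 < n - i.+1)%N by rewrite subn_gt0.
have -> : (n * 'C(n - i.+1, i.+1) =
          (n - i.+1) * ('C(n - i.+1, i.+1) + 'C(n - i.+2, i)))%N.
  rewrite mulnDr (subnS n i.+1) mul_bin_diag -mulnDl.
  by rewrite subnK // ltnW.
by rewrite mulKn.
Qed.

Lemma dickson_coef_small (n i : nat) : (0 < i)%N -> (n < i.*2)%N ->
  dickson_coef n i = 0%N.
Proof.
by move=> i_gt0 lt_n_2i; rewrite /dickson_coef bin_small ?muln0 ?div0n //; lia.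
Qed.

Lemma dickson_coef_rec (n i : nat) : (0 < n)%N ->
  dickson_coef n.+2 i.+1 = (dickson_coef n.+1 i.+1 + dickson_coef n i)%N.
Proof.
move=> n_gt0; have [lt_in | le_ni] := ltnP i n; last first.
  by rewrite !dickson_coef_small //; lia.
rewrite dickson_coefS; last by lia.
rewrite dickson_coefS // !subSS subSn 1?ltnW // binS.
case: i lt_in => [|i] lt_in; first by rewrite dickson_coef0 // !subn0 !bin0; lia.
have -> : (n - i.+1 = (n - i.+2).+1)%N by lia.
rewrite (dickson_coefS lt_in) (_ : n - i.+1 = (n - i.+2).+1)%N; last by lia.
by rewrite !binS; lia.
Qed.

(** The extra terms have coefficient 0. This gives the three sums of the recurrence compatible
    ranges. *)
Lemma dickson_widen (R : nzRingType) (n N : nat) (a : R) : (n <= N)%N ->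
  (0 < n)%N -> dickson n a =
    \sum_(i < N.+1) ((- a) ^+ i *+ dickson_coef n i) *: 'X^(n - i.*2).
Proof.
move=> le_nN n_gt0; rewrite /dickson.
have le_h : (n./2.+1 <= N.+1)%N by lia.
rewrite (big_ord_widen _ (fun i => ((- a) ^+ i *+ dickson_coef n i) *: 'X^(n - i.*2)) le_h).
rewrite big_mkcond; apply: eq_bigr => i _; case: ifP => // /negbT.
rewrite -leqNgt => le_hi; rewrite dickson_coef_small ?mulr0n ?scale0r //; lia.
Qed.

Lemma dickson1 (R : nzRingType) (a : R) : dickson 1 a = 'X.
Proof. by rewrite /dickson big_ord1 /= dickson_coef0 // expr0 scale1r expr1. Qed.

Lemma dickson2 (R : nzRingType) (a : R) : dickson 2 a = 'X^2 - (a *+ 2)%:P.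
Proof.
rewrite /dickson big_ord_recr big_ord1 /= dickson_coef0 // expr0 scale1r.
rewrite (_ : dickson_coef 2 1 = 2)%N // expr1 mulNrn scaleNr.
by rewrite expr0 -mul_polyC mulr1.
Qed.

(** The recurrence starts at n = 1 because [dickson 0 a] is 0 instead of the conventional 2;
    inductions based on it therefore have the two base cases 1 and 2. *)
Lemma dickson_rec (R : comNzRingType) (n : nat) (a : R) : (0 < n)%N ->
  dickson n.+2 a = 'X * dickson n.+1 a - a%:P * dickson n a.
Proof.
move=> n_gt0; rewrite (@dickson_widen _ n.+2 n.+2) //.
rewrite (@dickson_widen _ n.+1 n.+2) // (@dickson_widen _ n n.+1) //.
rewrite big_ord_recl [X in _ = 'X * X - _]big_ord_recl /=.
rewrite !dickson_coef0 // !mulr1n expr0 !scale1r !subn0 mulrDr -exprS -addrA.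
congr (_ + _); rewrite !mulr_sumr -sumrN -big_split /=.
apply: eq_bigr => i _; rewrite /bump /= add1n (dickson_coef_rec _ n_gt0).
rewrite mulrnDr scalerDl doubleS !subSS; congr (_ + _).
  (* The exponents agree only while the truncated subtraction is exact, that is for 2i + 1 <= n;
     beyond that the coefficient vanishes. *)
  rewrite -scalerAr -exprS; have [le_in | lt_ni] := leqP i.*2.+1 n.
    by congr (_ *: 'X^_); lia.
  by rewrite dickson_coef_small ?mulr0n ?scale0r //; lia.
by rewrite mul_polyC scalerA -scaleNr exprS mulrnAr mulNr mulNrn.
Qed.

Lemma dickson_size_monic (R : comNzRingType) (n : nat) (a : R) : (0 < n)%N ->
  size (dickson n a) = n.+1 /\ dickson n a \is monic.
Proof.
elim/ltn_ind: n => -[//|[|[|n]]] IH _.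
- by rewrite dickson1 size_polyX monicX.
- rewrite dickson2; have ltC: (size (- (a *+ 2)%:P)%R < size ('X^2 : {poly R}))%N.
    by rewrite size_polyN size_polyXn (leq_ltn_trans (size_polyC_leq1 _)).
  by rewrite size_polyDl // size_polyXn monicE lead_coefDl // lead_coefXn.
have [|//|sz1 m1] := IH n.+2; first by lia.
have [|//|sz2 m2] := IH n.+1; first by lia.
rewrite dickson_rec // mulrC.
have szX: size (dickson n.+2 a * 'X) = n.+4 by rewrite size_mulX ?sz1 // -size_poly_gt0 sz1.
have lt: (size (- (a%:P * dickson n.+1 a))%R < size (dickson n.+2 a * 'X)%R)%N.
  rewrite szX size_polyN mul_polyC (leq_ltn_trans (size_scale_leq _ _)) //.
  by rewrite sz2.
by rewrite size_polyDl // szX monicE lead_coefDl // lead_coefMX.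
Qed.

Lemma size_dickson (R : comNzRingType) (n : nat) (a : R) :
  (0 < n)%N -> size (dickson n a) = n.+1.
Proof. by case/(dickson_size_monic a). Qed.

Lemma dickson_monic (R : comNzRingType) (n : nat) (a : R) :
  (0 < n)%N -> dickson n a \is monic.
Proof. by case/(dickson_size_monic a). Qed.

(** Both sides satisfy s_(n+2) = b (y + 1/y) s_(n+1) - b^2 s_n. *)
Lemma horner_dickson (R : fieldType) (n : nat) (b y : R) :
  (0 < n)%N -> y != 0 ->
  (dickson n (b ^+ 2)).[b * (y + y^-1)] = b ^+ n * (y ^+ n + y ^- n).
Proof.
move=> + y_neq0; elim/ltn_ind: n => -[//|[|[|n]]] IH _.
- by rewrite dickson1 hornerX !expr1.
- rewrite dickson2 !hornerE; field; exact: y_neq0.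
rewrite dickson_rec // !hornerE (IH n.+2) // (IH n.+1) //.
rewrite !exprS; field; by rewrite y_neq0 expf_neq0.
Qed.

Lemma map_dickson (R S : comNzRingType) (h : {rmorphism R -> S}) (n : nat) (a : R) :
  map_poly h (dickson n a) = dickson n (h a).
Proof.
rewrite /dickson rmorph_sum; apply: eq_bigr => i _ /=.
by rewrite map_polyZ map_polyXn rmorphMn rmorphXn rmorphN.
Qed.

Lemma monic_size_dickson_sub (R : comNzRingType) (t : nat) (a c : R) :
  (0 < t)%N ->
  dickson t a - c%:P \is monic /\ size (dickson t a - c%:P) = t.+1.
Proof.
move=> t_gt0; have lt : (size (- c%:P : {poly R})%R < size (dickson t a))%N.
  by rewrite size_dickson // size_polyN (leq_ltn_trans (size_polyC_leq1 _)).
by rewrite monicE lead_coefDl // size_polyDl // -monicE dickson_monic ?size_dickson.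
Qed.

(** * Arithmetic of gcds and radicals *)

(** Multiplied by s, the two quotients become lcm(a, s) and lcm(c, s), and the lcm is monotone for
    divisibility. *)
Lemma dvdn_div_gcd (a c s : nat) : (0 < s)%N -> (a %| c)%N ->
  (a %/ gcdn a s %| c %/ gcdn c s)%N.
Proof.
move=> s_gt0 dvd_ac.
have E m : (m %/ gcdn m s * s = lcmn m s)%N.
  by rewrite /lcmn divn_mulAC ?dvdn_gcdl.
rewrite -(dvdn_pmul2r s_gt0) !E dvdn_lcm dvdn_lcmr andbT.
by rewrite (dvdn_trans dvd_ac) ?dvdn_lcml.
Qed.

Lemma coprime_div_gcd (o s : nat) : (0 < o)%N ->
  coprime (o %/ gcdn o s) (s %/ gcdn o s).
Proof.
move=> o_gt0; have g_gt0: (0 < gcdn o s)%N by rewrite gcdn_gt0 o_gt0.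
rewrite /coprime -(eqn_pmul2r g_gt0) mul1n muln_gcdl.
by rewrite !divnK ?dvdn_gcdl ?dvdn_gcdr.
Qed.

Lemma prime_dvd_radn (p n : nat) : p \in primes n -> (p %| radn n)%N.
Proof. by move=> pn; rewrite /radn (big_rem p) //= dvdn_mulr. Qed.

Lemma radn_dvd (n m : nat) :
  (forall p, prime p -> (p %| n)%N -> (p %| m)%N) -> (radn n %| m)%N.
Proof.
move=> dvd_pm; rewrite /radn.
have: {subset primes n <= [pred p | prime p && (p %| m)%N]}.
  move=> p; rewrite mem_primes => /and3P[pr_p _ pn] /=.
  by rewrite inE pr_p dvd_pm.
elim: (primes n) (primes_uniq n) => [|p s IH] /=; first by rewrite big_nil dvd1n.
case/andP=> p_s us sub; rewrite big_cons.
have /andP[pr_p pm] := sub p (mem_head _ _).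
rewrite Gauss_dvd ?pm ?IH // => [x xs|]; first by rewrite sub // inE xs orbT.
rewrite prime_coprime // Euclid_dvd_prod // big_has; apply/hasPn => r rs /=.
have /andP[pr_r _]: r \in [pred p | prime p && (p %| m)%N].
  by rewrite sub // inE rs orbT.
by rewrite dvdn_prime2 //; apply: contraNneq p_s => ->.
Qed.

(** * Lifting the exponent through geometric sums *)

(** Exponents below pm are written uniquely as i + mj with i < m and j < p. This peels one prime
    factor p off the length of a geometric sum. *)
Lemma geom_sumM (R m p : nat) :
  (\sum_(i < p * m) R ^ i =
    (\sum_(i < m) R ^ i) * (\sum_(i < p) (R ^ m) ^ i))%N.
Proof.
elim: p => [|p IH]; first by rewrite mul0n !big_ord0 muln0.
rewrite mulSnr big_split_ord IH [X in (_ = _ * X)%N]big_ord_recr mulnDr /=.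
congr addn; rewrite big_distrl; apply: eq_bigr => i _.
by rewrite expnD -expnM (mulnC m) mulnC.
Qed.

Lemma geom_sum_mod (R p m : nat) : (R = 1 %[mod p] ->
  \sum_(i < m) R ^ i = m %[mod p])%N.
Proof.
move=> R1; elim: m => [|m IH]; first by rewrite big_ord0.
by rewrite big_ord_recr /= -modnDm IH -modnXm R1 modnXm exp1n modnDm addn1.
Qed.

(* Writing R = 1 + pu, the sum is p + u * p * 'C(p, 2) modulo p^2. *)
Lemma logn_geom_prime (R p : nat) : prime p -> (R = 1 %[mod p])%N ->
  (p = 2 -> R = 1 %[mod 4])%N -> logn p (\sum_(i < p) R ^ i)%N = 1%N.
Proof.
move=> pr_p R1 R2; have p_gt1 := prime_gt1 pr_p.
have [p2|p_odd] := eqVneq p 2%N.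
  rewrite p2 big_ord_recr big_ord1 /= expn0 expn1.
  have R4 := R2 p2; have -> : (1 + R = 2 ^ 1 * (R %/ 4).*2.+1)%N.
    by rewrite {1}(divn_eq R 4) R4 modn_small //; lia.
  by rewrite lognM // pfactorK // lognE /= dvdn2 /= odd_double.
have [R0|R_gt0] := posnP R; first by rewrite R0 mod0n modn_small in R1.
have [u Ru]: exists u, R = (u * p).+1.
  have /eqP := R1; rewrite eqn_mod_dvd // => /dvdnP[u Ru].
  by exists u; rewrite -Ru; lia.
have Ri i : (R ^ i = 1 + i * (u * p) %[mod p ^ 2])%N.
  elim: i => // i IH; rewrite expnS -modnMmr IH modnMmr Ru.
  have -> : ((u * p).+1 * (1 + i * (u * p)) = i * u ^ 2 * p ^ 2 + (1 + i.+1 * (u * p)))%N.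
    rewrite !expnS expn0; nia.
  by rewrite modnMDl.
have S : (\sum_(i < p) R ^ i = p %[mod p ^ 2])%N.
  have : (\sum_(i < p) R ^ i = \sum_(i < p) (1 + i * (u * p)) %[mod p ^ 2])%N.
    by apply: (big_ind2 (fun x y => x = y %[mod p ^ 2])%N) => // x1 x2 y1 y2 E1 E2;
       rewrite -modnDm E1 E2 modnDm.
  move->; rewrite big_split /= sum1_card card_ord -big_distrl /= addnC.
  have -> : (\sum_(i < p) i = 'C(p, 2))%N by rewrite -bin2_sum big_mkord.
  have /dvdnP[k ->] : (p %| 'C(p, 2))%N by rewrite prime_dvd_bin //; lia.
  have -> : (k * p * (u * p) + p = k * u * p ^ 2 + p)%N by rewrite expnS expn1; lia.
  by rewrite modnMDl.
have p2lt: (p < p ^ 2)%N by rewrite expnS expn1; nia.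
have := divn_eq (\sum_(i < p) R ^ i) (p ^ 2).
rewrite S modn_small // => ->; set k := (_ %/ _)%N.
have -> : (k * p ^ 2 + p = p * (k * p).+1)%N by rewrite expnS expn1; lia.
have p_gt0 := prime_gt0 pr_p; rewrite lognM // logn_prime // eqxx logn_coprime //.
by rewrite prime_coprime // -addn1 dvdn_addr ?dvdn_mull // dvdn1 (gtn_eqF p_gt1).
Qed.

Lemma geom_sum_gt0 (R m : nat) : (0 < m)%N -> (0 < \sum_(i < m) R ^ i)%N.
Proof. by case: m => // m _; rewrite big_ord_recl expn0. Qed.

(** Induction on m. If p does not divide m, the sum is congruent to m modulo p, hence prime to p. If
    m = kp, the sum is the one of length k times a sum of p powers of R^k, whose valuation is
    exactly 1. *)
Lemma logn_geom_sum (R p m : nat) : prime p -> (R = 1 %[mod p])%N ->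
  (p = 2 -> R = 1 %[mod 4])%N -> (0 < m)%N ->
  logn p (\sum_(i < m) R ^ i)%N = logn p m.
Proof.
move=> pr_p R1 R2; elim/ltn_ind: m => m IH m_gt0.
have [/dvdnP[k Dm]|pm] := boolP (p %| m)%N; last first.
  rewrite !logn_coprime ?prime_coprime //.
  by rewrite /dvdn geom_sum_mod.
have p_gt1 := prime_gt1 pr_p.
have k_gt0: (0 < k)%N by rewrite Dm in m_gt0; nia.
have Rk N : (R = 1 %[mod N])%N -> (R ^ k = 1 %[mod N])%N.
  by move=> RN; rewrite -modnXm RN modnXm exp1n.
have p_gt0 := ltnW p_gt1; rewrite Dm mulnC geom_sumM !lognM ?geom_sum_gt0 //.
rewrite IH //; last by rewrite Dm; nia.
rewrite logn_geom_prime //; last 2 first.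
- exact: Rk.
- by move/R2/Rk.
by rewrite (logn_prime _ pr_p) eqxx addnC.
Qed.

(* Lifting the exponent: (Q^i - 1)/(Q - 1) and i have the same p-adic valuation
   for every prime p dividing Q - 1, so that the order of Q modulo o is
   o / gcd(o, Q - 1). *)
Lemma order_modn_dvd (Q o i : nat) : (4 %| Q - 1)%N -> (1 < Q)%N -> (0 < o)%N ->
  (forall p, prime p -> (p %| o)%N -> (p %| Q - 1)%N) ->
  (0 < i)%N -> (o %| Q ^ i - 1)%N -> (o %/ gcdn o (Q - 1) %| i)%N.
Proof.
move=> Q4 Q_gt1 o_gt0 rad_o i_gt0 o_dvd.
have g_gt0: (0 < gcdn o (Q - 1))%N by rewrite gcdn_gt0 o_gt0.
have Q1 N : (N %| Q - 1)%N -> (Q = 1 %[mod N])%N.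
  by move=> NQ; apply/eqP; rewrite eqn_mod_dvd // ltnW.
have cop := coprime_div_gcd (Q - 1) o_gt0.
have t_gt0: (0 < o %/ gcdn o (Q - 1))%N by rewrite divn_gt0 // dvdn_leq // dvdn_gcdl.
apply/dvdn_partP => // p; rewrite mem_primes => /and3P[pr_p _ pt].
have po: (p %| o)%N by apply: dvdn_trans pt (dvdn_div (dvdn_gcdl _ _)).
rewrite p_part pfactor_dvdn // -(@logn_geom_sum Q p i) //; last 2 first.
- exact/Q1/rad_o.
- by move=> _; apply: Q1.
apply: dvdn_leq_log; rewrite ?geom_sum_gt0 //.
(* Here o divides (Q - 1) times the geometric sum; after division by the gcd, coprimality removes
   the factor coming from Q - 1. *)
rewrite -(Gauss_dvdr _ cop) -(dvdn_pmul2r g_gt0) divnK ?dvdn_gcdl //.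
rewrite mulnAC divnK ?dvdn_gcdr // subn1 -predn_exp -subn1 //.
Qed.

(** * Frobenius powers and descent to finite subfields *)

(** An iterate of Frobenius. The condition on m is an argument so that the function can carry a ring
    morphism structure. *)
Definition powpchar (R : comNzRingType) (m : nat) of [pchar R].-nat m :=
  fun x : R => x ^+ m.

Section PowerMorphism.
Variables (R : comNzRingType) (m : nat) (charm : [pchar R].-nat m).

Lemma powpchar_is_nmod_morphism : nmod_morphism (powpchar charm).
Proof.
split=> [|x y]; rewrite /powpchar ?exprDn_pchar //.
by rewrite expr0n; case: m charm.
Qed.

Lemma powpchar_is_monoid_morphism : monoid_morphism (powpchar charm).
Proof. by split=> [|x y]; rewrite /powpchar ?expr1n ?exprMn. Qed.

HB.instance Definition _ :=
  GRing.isNmodMorphism.Build R R (powpchar charm) powpchar_is_nmod_morphism.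
HB.instance Definition _ :=
  GRing.isMonoidMorphism.Build R R (powpchar charm) powpchar_is_monoid_morphism.

End PowerMorphism.

Lemma pchar_nat_card (F : finFieldType) (R : nzRingType) (h : {rmorphism F -> R}) :
  [pchar R].-nat #|F|.
Proof.
have [p _ charFp] := finPcharP F.
rewrite (eq_pnat _ (pcharf_eq (rmorph_pchar h charFp))) (card_pprimeChar charFp).
by rewrite pnatX pnat_id ?(pcharf_prime charFp).
Qed.

(** Over F the polynomial X^#|F| - X is the product of all X - u, so its roots in K are the images
    of the elements of F. *)
Lemma expf_card_codom (F : finFieldType) (K : fieldType)
    (h : {rmorphism F -> K}) (z : K) :
  z ^+ #|F| = z -> exists u, z = h u.
Proof.
move=> zq; have: root (map_poly h ('X^#|F| - 'X)) z.
  by rewrite rmorphB /= map_polyXn map_polyX rootE !hornerE zq subrr.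
rewrite finField_genPoly rmorph_prod /=.
have -> : \prod_x map_poly h ('X - x%:P) =
          \prod_(z <- [seq h x | x : F]) ('X - z%:P).
  rewrite big_image /=; apply: eq_bigr => x _.
  by rewrite rmorphB /= map_polyX map_polyC.
by rewrite root_prod_XsubC => /mapP[u _ ->]; exists u.
Qed.

Lemma poly_expf_card_codom (F : finFieldType) (K : fieldType)
    (h : {rmorphism F -> K}) (p : {poly K}) :
  (forall i, p`_i ^+ #|F| = p`_i) -> exists r, p = map_poly h r.
Proof.
move=> pq; pose g z := odflt 0 [pick u | h u == z].
have gK z : z ^+ #|F| = z -> h (g z) = z.
  case/(@expf_card_codom _ _ h)=> u ->; rewrite /g; case: pickP => [v /eqP-> //|].
  by move/(_ u); rewrite eqxx.
exists (\poly_(i < size p) g p`_i); apply/polyP => i.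
rewrite coef_map coef_poly /=; case: ltnP => [_|le_pi]; first by rewrite gK.
by rewrite rmorph0 nth_default.
Qed.

(** The #|L|-power Frobenius of K fixes the coefficients coming from L, so it permutes the roots. *)
Lemma root_map_expf_card (L : finFieldType) (K : fieldType)
    (j : {rmorphism L -> K}) (p : {poly L}) (z : K) (i : nat) :
  root (map_poly j p) z -> root (map_poly j p) (z ^+ (#|L| ^ i)).
Proof.
move=> pz; elim: i => [|i IH]; first by rewrite expn0 expr1.
rewrite expnSr exprM; have cL := pchar_nat_card j.
suff <- : map_poly (powpchar cL) (map_poly j p) = map_poly j p.
  exact: (rmorph_root (powpchar cL) IH).
apply/polyP => k; rewrite coef_map !coef_map /= /powpchar -rmorphXn /=.
by rewrite expf_card.
Qed.

(** * Conjugates of b (y + 1/y) and its minimal polynomial *)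

Lemma addf_inv_inj (K : fieldType) (u v : K) : u != 0 -> v != 0 ->
  u + u^-1 = v + v^-1 -> u = v \/ u * v = 1.
Proof.
move=> u0 v0 E; have : (u - v) * (u * v - 1) = 0.
  have -> : (u - v) * (u * v - 1) = u * v * ((u + u^-1) - (v + v^-1)).
    by field; rewrite u0 v0.
  by rewrite E subrr mulr0.
by move/eqP; rewrite mulf_eq0 !subr_eq0 => /orP[] /eqP; [left | right].
Qed.

(* The conjugates b (y^(Q^i) + y^-(Q^i)), i < t, of the root b (y + 1/y) are
   pairwise distinct, hence they are all the roots of the left-hand side. *)
Lemma dickson_sub_dvd (L : finFieldType) (K : fieldType)
    (j : {rmorphism L -> K}) (o t : nat) (y : K) (b alpha : L) (p : {poly L}) :
  (4 %| #|L| - 1)%N ->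
  (forall r, prime r -> (r %| o)%N -> (r %| #|L| - 1)%N) ->
  o.-primitive_root y -> t = (o %/ gcdn o (#|L| - 1))%N ->
  j alpha = y ^+ t -> alpha ^+ 2 != 1 -> b != 0 ->
  root (map_poly j p) (j b * (y + y^-1)) ->
  dickson t (b ^+ 2) - (b ^+ t * (alpha + alpha^-1))%:P %| p.
Proof.
move=> Q4 rad_o prim_y Dt alphaE alpha2 b_neq0 px.
set g := (X in X %| p); set Q := #|L| in Q4 rad_o Dt *.
have Q_gt1 : (1 < Q)%N by apply: finNzRing_gt1.
have o_gt0 := prim_order_gt0 prim_y.
have t_gt0 : (0 < t)%N.
  by rewrite Dt divn_gt0 ?gcdn_gt0 ?o_gt0 // dvdn_leq // dvdn_gcdl.
have y_neq0 : y != 0.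
  apply: contra_eq_neq (prim_expr_order prim_y) => ->.
  by rewrite expr0n gtn_eqF // eq_sym oner_neq0.
have jb_neq0 : j b != 0 by rewrite fmorph_eq0.
have cQ i : [pchar K].-nat (Q ^ i)%N by rewrite pnatX (pchar_nat_card j).
pose s := [seq (j b * (y + y^-1)) ^+ (Q ^ i) | i <- iota 0 t].
have bQ i : j b ^+ (Q ^ i) = j b.
  elim: i => [|i IH]; first by rewrite expn0 expr1.
  by rewrite expnSr exprM IH -rmorphXn /= expf_card.
have alphaQ i : alpha ^+ (Q ^ i) = alpha.
  elim: i => [|i IH]; first by rewrite expn0 expr1.
  by rewrite expnSr exprM IH expf_card.
have sE i : (j b * (y + y^-1)) ^+ (Q ^ i) = j b * (y ^+ (Q ^ i) + y ^- (Q ^ i)).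
  by rewrite exprMn bQ exprDn_pchar ?cQ // exprVn.
have neq i k : (i < k < t)%N ->
    (j b * (y + y^-1)) ^+ (Q ^ i) != (j b * (y + y^-1)) ^+ (Q ^ k).
  case/andP=> lt_ik lt_kt; rewrite !sE; apply/eqP => /(mulfI jb_neq0) E.
  have [yi yk] : y ^+ (Q ^ i) != 0 /\ y ^+ (Q ^ k) != 0 by rewrite !expf_neq0.
  case: (addf_inv_inj yi yk E) => Ey.
    have : (o %| Q ^ k - Q ^ i)%N.
      by rewrite -eqn_mod_dvd ?leq_exp2l ?(ltnW lt_ik) // eq_sym
        -(eq_prim_root_expr prim_y) Ey.
    rewrite (_ : Q ^ k - Q ^ i = Q ^ i * (Q ^ (k - i) - 1))%N; last first.
      by rewrite mulnBr muln1 -expnD subnKC // ltnW.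
    (* A prime dividing both o and Q would divide Q - 1 by [rad_o], hence 1. *)
    have copoQ : coprime o (Q ^ i).
      apply: coprimeXr; apply: contraT; rewrite /coprime => g_neq1.
      have g_gt1 : (1 < gcdn o Q)%N by rewrite ltn_neqAle eq_sym g_neq1 gcdn_gt0 o_gt0.
      have pr_g := pdiv_prime g_gt1; have := pdiv_dvd (gcdn o Q).
      rewrite dvdn_gcd => /andP[go gQ].
      have := rad_o _ pr_g go; rewrite dvdn_subr ?(ltnW Q_gt1) //.
      by rewrite dvdn1 (gtn_eqF (prime_gt1 pr_g)).
    rewrite Gauss_dvdr // => o_dvd.
    have ki_gt0 : (0 < k - i)%N by rewrite subn_gt0.
    have := order_modn_dvd Q4 Q_gt1 o_gt0 rad_o ki_gt0 o_dvd.
    by rewrite -Dt => /(dvdn_leq ki_gt0); rewrite leqNgt (leq_ltn_trans (leq_subr _ _)).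
  (* Now y^(Q^i) y^(Q^k) = 1. Its t-th power is alpha^(Q^i) alpha^(Q^k) = alpha^2, as alpha is fixed
     by the Q-power map. *)
  case/eqP: alpha2; apply: (fmorph_inj j); rewrite rmorph1 expr2.
  rewrite -[X in X * _](alphaQ i) -[X in _ * X](alphaQ k) rmorphM !rmorphXn /= alphaE.
  by rewrite -!exprM !(mulnC t) !exprM -exprMn Ey expr1n.
have us : uniq s.
  rewrite map_inj_in_uniq ?iota_uniq // => i k.
  rewrite !mem_iota !add0n /= => lt_it lt_kt E.
  case: (ltngtP i k) => // [lt_ik|lt_ki].
    by have := neq i k; rewrite lt_ik lt_kt E eqxx => /(_ isT).
  by have := neq k i; rewrite lt_ki lt_it E eqxx => /(_ isT).
have s_dvd r : root (map_poly j r) (j b * (y + y^-1)) ->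
    \prod_(z <- s) ('X - z%:P) %| map_poly j r.
  move=> rx; apply: uniq_roots_dvdp; last by rewrite uniq_rootsE.
  by apply/allP => _ /mapP[i _ ->]; apply: root_map_expf_card.
have [gm szg] : g \is monic /\ size g = t.+1 by apply: monic_size_dickson_sub.
have gx : root (map_poly j g) (j b * (y + y^-1)).
  rewrite /g rmorphB /= map_dickson map_polyC rootE /= rmorphXn /=.
  rewrite !hornerE horner_dickson // rmorphM rmorphXn rmorphD /=.
  by rewrite fmorphV alphaE subrr.
rewrite -(dvdp_map j).
(* The product over the t conjugates divides the image of any polynomial over L that vanishes at the
   root, in particular those of [p] and [g]; being monic of degree t, like [g], it equals the image
   of [g]. *)
suff <- : \prod_(z <- s) ('X - z%:P) = map_poly j g by apply: s_dvd.
apply/eqP; rewrite -eqp_monic ?monic_prod_XsubC ?monic_map //.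
by rewrite -dvdp_size_eqp ?s_dvd // size_prod_XsubC size_map size_iota size_map_poly szg.
Qed.

Lemma coprimep_subC (K : fieldType) (p : {poly K}) (c1 c2 : K) :
  c1 != c2 -> coprimep (p - c1%:P) (p - c2%:P).
Proof.
move=> neq_c; have c_neq0 : c2 - c1 != 0 by rewrite subr_eq0 eq_sym.
rewrite /coprimep -dvdp1 -(dvdpZr _ _ c_neq0) -mul_polyC mulr1 polyCB.
have -> : c2%:P - c1%:P = (p - c1%:P) - (p - c2%:P) by ring.
by rewrite dvdp_sub ?dvdp_gcdl ?dvdp_gcdr.
Qed.

(** * Irreducible factors over F_q *)

(** The Frobenius-fixed coefficients of g come from F, so g is the image of a nonconstant monic
    divisor of the irreducible f. *)
Lemma irreducible_map_eq (F : finFieldType) (K : fieldType)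
    (h : {rmorphism F -> K}) (f : {poly F}) (g : {poly K}) :
  f \is monic -> irreducible_poly f -> g \is monic -> size g != 1%N ->
  (forall i, g`_i ^+ #|F| = g`_i) -> g %| map_poly h f -> map_poly h f = g.
Proof.
move=> f_monic [_ f_irr] g_monic sz_g /(@poly_expf_card_codom _ _ h)[r Dg].
move: g_monic sz_g; rewrite {}Dg map_monic size_map_poly => r_monic sz_r.
rewrite dvdp_map => /(f_irr _ sz_r); rewrite eqp_monic // => /eqP-> //.
Qed.

Lemma addf_inv_surj (K : closedFieldType) (z : K) :
  exists2 y, y != 0 & z = y + y^-1.
Proof.
(* The equation solved is y^2 = z y - 1. *)
have [y Dy] := @solve_monicpoly K 2 (fun i => if i == 0%N then -1 else z) isT.
rewrite big_ord_recr big_ord1 /= expr0 expr1 mulr1 in Dy.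
have y_neq0 : y != 0.
  apply/eqP => y0; move/eqP: Dy; rewrite y0 mulr0 addr0 expr0n /= eq_sym.
  by rewrite oppr_eq0 oner_eq0.
exists y => //; apply: (mulIf y_neq0); rewrite mulrDl mulVf // -expr2 Dy.
by rewrite addrAC addNr add0r.
Qed.

Theorem theorem3p2 (q : nat) (F L : finFieldType) (iota : {rmorphism F -> L})
    (hF : #|F| = q) (hL : #|L| = (q ^ 2)%N) (hq : (q %% 4 = 3)%N)
    (a b : F) (ha : a != 0) (hb : b ^+ 2 = a)
    (n : nat) (n_gt0 : (0 < n)%N) (n_even : ~~ odd n)
    (hn : (radn n %| q - 1)%N)
    (f : {poly F}) (f_monic : f \is monic) (f_irr : irreducible_poly f)
    (f_dvd : f %| dickson n a) :
  exists (alpha : {unit L}) (t : nat),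
    [/\ (0 < t)%N /\ (t %| (4 * n) %/ gcdn (4 * n) (q ^ 2 - 1))%N,
        val alpha ^+ ((2 * n) %/ t) = -1,
        (radn t %| #[alpha]%g)%N,
        coprime t ((q ^ 2 - 1) %/ #[alpha]%g) &
        if (val alpha \in codom iota) || (val alpha ^+ (q + 1) == 1)
        then map_poly iota f =
             dickson t (iota a)
             - (iota b ^+ t * (val alpha + (val alpha)^-1))%:P
        else map_poly iota f =
             (dickson t (iota a)
              - (iota b ^+ t * (val alpha + (val alpha)^-1))%:P)
             * (dickson t (iota a)
                - (iota b ^+ t * (val alpha ^+ q + val alpha ^- q))%:P)].
Proof.
have n4E : (4 * n = 2 * n * 2)%N by lia.
have q2E : (q ^ 2 - 1 = (q - 1) * (q + 1))%N by rewrite expnS expn1; lia.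
have q1_even : (2 %| q - 1)%N by lia.
have q_gt2 : (2 < q)%N by lia.
have s_gt0 : (0 < q ^ 2 - 1)%N by rewrite q2E; nia.
(* Since q is 3 modulo 4, 4 divides q + 1. Lifting the exponent at the prime 2 relies on this. *)
have s4 : (4 %| q ^ 2 - 1)%N by rewrite q2E dvdn_mull //; lia.
have b_neq0 : iota b != 0.
  by rewrite fmorph_eq0; apply: contraNneq ha => b0; rewrite -hb b0 expr0n.
have iota_b2 : iota b ^+ 2 = iota a by rewrite -rmorphXn /= hb.
(* In characteristic 2, q would be a power of 2, contradicting q = 3 modulo 4. *)
have N1_neq1 : -1 != 1 :> L.
  rewrite eq_sym -addr_eq0 -[1 + 1]/(2%:R); apply/negP => two0.
  have char2 : 2%N \in [pchar L] by rewrite inE two0.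
  have := pchar_nat_card iota; rewrite hF (eq_pnat _ (pcharf_eq char2)).
  by case/p_natP => -[|k] E; move: q_gt2 hq; rewrite E // expnS; lia.
have [K [j _]] := countable_algebraic_closure L.
have [x fx] : exists x, root (map_poly j (map_poly iota f)) x.
  apply/closed_rootP; rewrite !size_map_poly.
  by case: f_irr => sz_f _; rewrite gtn_eqF.
have [y y_neq0 Dx] := addf_inv_surj (x / j (iota b)).
have jb_neq0 : j (iota b) != 0 by rewrite fmorph_eq0.
have {Dx}Dx : x = j (iota b) * (y + y^-1) by rewrite -Dx mulrC divfK.
have y2n : y ^+ (2 * n) = -1.
  have /(dvdp_trans _) : map_poly j (map_poly iota f) %|
      dickson n (j (iota b) ^+ 2).
    by rewrite -rmorphXn /= iota_b2 -!map_dickson !dvdp_map.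
  move/(_ _ (etrans (dvdp_XsubCl _ _) fx)); rewrite dvdp_XsubCl Dx rootE.
  rewrite horner_dickson // mulf_eq0 expf_eq0 (negPf jb_neq0) andbF /=.
  rewrite addr_eq0 => /eqP Ey; rewrite mulnC exprM expr2 {1}Ey mulNr mulVf //.
  by rewrite expf_neq0.
have [||o prim_y o_dvd] := @prim_order_exists _ (4 * n) y.
- by rewrite muln_gt0.
- by rewrite n4E (exprM _ (2 * n)%N) y2n sqrrN expr1n.
have o_gt0 := prim_order_gt0 prim_y.
have o_ndvd : ~~ (o %| 2 * n)%N.
  rewrite (prim_order_dvd prim_y) y2n -(rmorphN1 j) fmorph_eq1.
  exact: N1_neq1.
have o_even : (2 %| o)%N.
  rewrite dvdn2; apply: contra o_ndvd => o_odd; rewrite -(@Gauss_dvdr _ 2) ?coprimen2 //.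
  by rewrite mulnA.
have rad_o r : prime r -> (r %| o)%N -> (r %| q ^ 2 - 1)%N.
  move=> pr_r r_o; rewrite q2E dvdn_mulr //.
  have := dvdn_trans r_o o_dvd; rewrite Euclid_dvdM // => /orP[r4|r_n].
    have : (r %| 2 ^ 2)%N by []; rewrite Euclid_dvdX // andbT dvdn_prime2 //.
    by move/eqP->.
  apply: dvdn_trans hn; apply: prime_dvd_radn.
  by rewrite mem_primes pr_r n_gt0.
pose d := gcdn o (q ^ 2 - 1); pose t := (o %/ d)%N.
have d_gt0 : (0 < d)%N by rewrite gcdn_gt0 o_gt0.
have oE : (o = t * d)%N by rewrite divnK ?dvdn_gcdl.
have t_gt0 : (0 < t)%N by move: o_gt0; rewrite oE muln_gt0 => /andP[].
(* This will say alpha^2 != 1, since alpha has order d. If d divided 2, then 4 would not divide o,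
   because 4 divides q^2 - 1; so o would be twice an odd number, and o | 4n would give o | 2n. *)
have d_ndvd2 : ~~ (d %| 2)%N.
  apply: contra o_ndvd => d2; have o4 : ~~ (4 %| o)%N.
    by apply/negP => o4; have := dvdn_trans (_ : 4 %| d)%N d2; rewrite dvdn_gcd o4 s4 => /(_ isT).
  rewrite -(divnK o_even) in o4 o_dvd *; rewrite mulnC dvdn_pmul2l //.
  rewrite (@dvdn_pmul2r 2 2) // dvdn2 negbK in o4.
  rewrite n4E dvdn_pmul2r // Gauss_dvdr ?coprimen2 // in o_dvd.
(* As d is even, 2t divides o = td and hence 4n. This makes the exponent 2n/t exact. *)
have t_2n : (t %| 2 * n)%N.
  rewrite -(@dvdn_pmul2r 2) // -n4E.
  apply: dvdn_trans o_dvd; rewrite oE dvdn_pmul2l // dvdn_gcd o_even.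
  exact: dvdn_trans s4.
(* Since o = td divides t (q^2 - 1), y^t is fixed by the q^2-power map. *)
have [alpha0 alphaE] : exists u, y ^+ t = j u.
  apply: expf_card_codom; rewrite hL -exprM; apply/eqP.
  rewrite (eq_prim_root_expr prim_y) -{2}(muln1 t) eqn_mod_dvd; last first.
    by rewrite leq_mul2l expn_gt0 (ltnW (ltnW q_gt2)) orbT.
  by rewrite -mulnBr oE dvdn_pmul2l // dvdn_gcdr.
have alpha_neq0 : alpha0 != 0.
  by rewrite -(fmorph_eq0 j) -alphaE expf_neq0.
pose alpha := finField_unit alpha_neq0.
have alphaX k : (alpha0 ^+ k == 1) = (d %| k)%N.
  rewrite -(fmorph_eq1 j) rmorphXn /= -alphaE -exprM -(prim_order_dvd prim_y).
  by rewrite oE dvdn_pmul2l.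
have ord_alpha : #[alpha]%g = d.
  have E k : (#[alpha]%g %| k)%N = (d %| k)%N.
    by rewrite order_dvdn -val_eqE FinRing.val_unitX FinRing.val_unit1 alphaX.
  by apply/eqP; rewrite eqn_dvd -E dvdnn E dvdnn.
exists alpha, t; rewrite ord_alpha; have -> : val alpha = alpha0 by [].
split.
- by split=> //; apply: dvdn_div_gcd.
- apply: (fmorph_inj j); rewrite rmorphXn rmorphN1 /= -alphaE -exprM.
  by rewrite mulnC divnK.
- apply: radn_dvd => r pr_r r_t; have r_o : (r %| o)%N by rewrite oE dvdn_mulr.
  by rewrite dvdn_gcd r_o rad_o.
- exact: coprime_div_gcd.
pose c (u : L) := iota b ^+ t * (u + u^-1).
pose g (u : L) := dickson t (iota a) - (c u)%:P.
have g_monic u : g u \is monic by case: (monic_size_dickson_sub (iota a) (c u) t_gt0).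
have g_size u : size (g u) = t.+1 by case: (monic_size_dickson_sub (iota a) (c u) t_gt0).
have cq : [pchar L].-nat q by rewrite -hF (pchar_nat_card iota).
(* The conjugation of L over F; it fixes a and b, so it sends [g u] to [g (sigma u)]. *)
pose sigma : {rmorphism L -> L} := powpchar cq.
have sigmaE u : sigma u = u ^+ q by [].
have sigma_iota u : sigma (iota u) = iota u.
  by rewrite sigmaE -rmorphXn /= -hF expf_card.
have sigma_c u : sigma (c u) = c (sigma u).
  by rewrite /c rmorphM rmorphXn sigma_iota rmorphD fmorphV.
have sigma_g u : map_poly sigma (g u) = g (sigma u).
  by rewrite /g rmorphB /= map_dickson map_polyC sigma_iota /= sigma_c.
have g_dvd : g alpha0 %| map_poly iota f.
  rewrite /g -iota_b2; apply: (@dickson_sub_dvd _ _ j o t y); rewrite ?hL //.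
  - by rewrite alphaX.
  - by rewrite -Dx.
case: ifP => [case1 | /norP[alpha_codom alpha_q1]].
  apply: irreducible_map_eq; rewrite ?g_monic ?g_size ?eqSS -?lt0n //.
  (* Here [sigma] sends alpha to itself or to its inverse, and [c] is symmetric under inversion. *)
  have fix_c : c (sigma alpha0) = c alpha0.
    case/orP: case1 => [/codomP[u ->]|]; first by rewrite sigma_iota.
    rewrite addn1 exprSr sigmaE => /eqP E.
    have -> : alpha0 ^+ q = alpha0^-1 by rewrite -[LHS](mulfK alpha_neq0) E mul1r.
    by rewrite /c invrK addrC.
  move=> i; rewrite hF -sigmaE -/(c alpha0) -/(g alpha0) -coef_map.
  by rewrite sigma_g /g fix_c.
have sigma2 : sigma (sigma alpha0) = alpha0.
  by rewrite !sigmaE -exprM mulnn -hL expf_card.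
have -> : alpha0 ^+ q + alpha0 ^- q = sigma alpha0 + (sigma alpha0)^-1 by [].
rewrite -/(c _) -/(c _) -/(g _) -/(g _).
have sigma_neq0 : sigma alpha0 != 0 by rewrite fmorph_eq0.
apply: irreducible_map_eq => //.
- by rewrite rpredM.
- by rewrite size_monicM ?monic_neq0 // !g_size addSn addnS /= eqSS -lt0n addn_gt0 t_gt0.
- by move=> i; rewrite hF -sigmaE -coef_map rmorphM /= !sigma_g sigma2 mulrC.
(* The two factors differ by a constant. Were it zero, alpha^q would be alpha, putting alpha in F,
   or its inverse, giving alpha^(q+1) = 1; both are excluded. *)
rewrite Gauss_dvdp ?g_dvd /=; last first.
  apply: coprimep_subC; apply/eqP => /(mulfI (expf_neq0 _ b_neq0)).
  case/(addf_inv_inj alpha_neq0 sigma_neq0) => E.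
    case/codomP: alpha_codom; apply: expf_card_codom.
    by rewrite hF -sigmaE -E.
  by case/eqP: alpha_q1; rewrite addn1 exprS -sigmaE.
(* The second factor divides f because it is the conjugate of the first and f has coefficients in
   F. *)
have -> : map_poly iota f = map_poly sigma (map_poly iota f).
  by apply/polyP => i; rewrite [RHS]coef_map !coef_map /= sigma_iota.
by rewrite -sigma_g dvdp_map.
Qed.
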